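(* For every rule set $\mathcal{R}$: if the TGD set $\mathsf{St}(\mathcal{R})$ is MFA, then $\mathcal{R}$ is EMFA.
   Context: Signature: finite sets of constants, function symbols, variables and predicates, predicates including binary equality $\approx$. Terms are built from constants and variables with function symbols; depth: $\mathrm{dep}(t)=1$ for constants/variables, $\mathrm{dep}(f(t_1,\dots,t_n))=\max_i\mathrm{dep}(t_i)+1$. A rule is a function- and constant-free formula, either a TGD $\forall\vec x\forall\vec y(\beta[\vec x,\vec y]\to\exists\vec w\,\eta[\vec x,\vec w])$ or an EGD $\forall\vec x(\beta[\vec x]\to x\approx y)$, where $\vec x,\vec y,\vec w$ are pairwise disjoint variable lists, $\vec x$ non-empty, $\beta,\eta$ non-empty conjunctions (treated as sets) of atoms not using $\approx$, $\varphi[\vec z]$ means $\vec z$ is exactly the free variables of $\varphi$, and $x,y\in\vec x$. A rule set is a finite set of rules in which no existentially quantified variable occurs in two different rules; a TGD set is a rule set with no EGDs. For a TGD, $\mathsf{Sk}(\eta)$ replaces each $w\in\vec w$ by $f_w(\vec x)$ with $f_w$ a fresh function symbol of arity $|\vec x|$ unique to $w$; for a substitution $\sigma$ (map from variables to ground terms), $\mathsf{Sk}_\sigma(\eta)$ replaces every syntactic occurrence of each variable $z$ in $\mathsf{Sk}(\eta)$ by $\sigma(z)$, and $\beta\sigma$ replaces each variable argument $z$ by $\sigma(z)$. For an atom set $\mathcal{M}$ and ground terms $t,u$, $\mathcal{M}[t/u]$ replaces every occurrence of $t$ directly as a predicate argument by $u$ (nested occurrences are not replaced). EMFA: the critical instance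 $\mathsf{CI}(\mathcal{R})$ is the set of all facts built from the predicates occurring in $\mathcal{R}$ and a special constant $\star$. $\mathsf{M}(\mathcal{R})$ is the minimal atom set such that: $\mathsf{CI}(\mathcal{R})\subseteq\mathsf{M}(\mathcal{R})$; for every TGD $\beta\to\exists\vec w.\eta\in\mathcal{R}$ and substitution $\sigma$ with $\beta\sigma\subseteq\mathsf{M}(\mathcal{R})$, $\mathsf{Sk}_\sigma(\eta)\subseteq\mathsf{M}(\mathcal{R})$; for every EGD $\beta\to x\approx y\in\mathcal{R}$ and substitution $\sigma$ with $\beta\sigma\subseteq\mathsf{M}(\mathcal{R})$, $\mathsf{M}(\mathcal{R})[\sigma(y)/\sigma(x)]\subseteq\mathsf{M}(\mathcal{R})$ if $\mathrm{dep}(\sigma(x))\le\mathrm{dep}(\sigma(y))$ and $\mathsf{M}(\mathcal{R})[\sigma(x)/\sigma(y)]\subseteq\mathsf{M}(\mathcal{R})$ if $\mathrm{dep}(\sigma(y))\le\mathrm{dep}(\sigma(x))$. A term is cyclic if it is of the form $f(\vec u)$ with $f$ occurring in some term of $\vec u$. $\mathcal{R}$ is EMFA if $\mathsf{M}(\mathcal{R})$ contains no cyclic terms; a TGD set is MFA if it is EMFA. Standard axiomatisation: let $\mathrm{Eq}$ be a fresh binary predicate. $\mathsf{St}(\mathcal{R})$ is the TGD set containing all TGDs of $\mathcal{R}$; the TGD $\beta\to\mathrm{Eq}(x,y)$ for every EGD $\beta\to x\approx y$ in $\mathcal{R}$; for every predicate $P\neq\approx$ occurring in $\mathcal{R}$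 of arity $n$, the rule $P(x_1,\dots,x_n)\to\bigwedge_{i=1}^n\mathrm{Eq}(x_i,x_i)$; the rules $\mathrm{Eq}(x,y)\to\mathrm{Eq}(y,x)$ and $\mathrm{Eq}(x,y)\wedge\mathrm{Eq}(y,z)\to\mathrm{Eq}(x,z)$; and for every such $P$ and $i\in\{1,\dots,n\}$ the rule $P(x_1,\dots,x_n)\wedge\mathrm{Eq}(x_i,x_i')\to P(x_1,\dots,x_{i-1},x_i',x_{i+1},\dots,x_n)$. *)

(* Defs.v *)
From HB Require Import structures.
From mathcomp Require Import all_boot.

Set Implicit Arguments.
Unset Strict Implicit.
Unset Printing Implicit Defensive.

(* [eqp] is the binary equality predicate. *)
Record signature := Signature {
  sconst : finType;
  sfunc : finType;
  svar : finType;
  spred : finType;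
  ar : spred -> nat;
  eqp : spred;
  ar_eqp : ar eqp = 2
}.

Arguments eqp {S} : rename.

(* Rules are function- and constant-free, so the arguments of their atoms are
   variables. Conjunctions are lists used only through membership.
   [Tgd xs ys ws body head] is
     forall xs ys, body[xs, ys] -> exists ws, head[xs, ws]
   and [Egd xs body x y] is  forall xs, body[xs] -> x = y.
   The order of [xs] matters: it is the order of the arguments of the Skolem
   terms. *)
Definition ratom (S : signature) : Type := (spred S * seq (svar S))%type.

Inductive rule (S : signature) : Type :=
| Tgd of seq (svar S) & seq (svar S) & seq (svar S)
    & seq (ratom S) & seq (ratom S)
| Egd of seq (svar S) & seq (ratom S) & svar S & svar S.

Section RuleEqType.
Variable S : signature.

Let code : eqType :=
  ((seq (svar S) * seq (svar S) * seq (svar S) *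
      seq (spred S * seq (svar S)) * seq (spred S * seq (svar S))) +
   (seq (svar S) * seq (spred S * seq (svar S)) * svar S * svar S))%type.

Definition rule_enc (r : rule S) : code :=
  match r with
  | Tgd xs ys ws b h => inl (xs, ys, ws, b, h)
  | Egd xs b x y => inr (xs, b, x, y)
  end.

Definition rule_dec (c : code) : rule S :=
  match c with
  | inl (xs, ys, ws, b, h) => Tgd xs ys ws b h
  | inr (xs, b, x, y) => Egd xs b x y
  end.

Lemma rule_encK : cancel rule_enc rule_dec.
Proof. by case. Qed.

HB.instance Definition _ := Equality.copy (rule S) (can_type rule_encK).

End RuleEqType.

Section Rules.
Variable S : signature.

Definition atoms_vars (b : seq (ratom S)) : seq (svar S) :=
  flatten [seq a.2 | a <- b].

Definition atoms_preds (b : seq (ratom S)) : seq (spred S) := [seq a.1 | a <- b].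

Definition wf_ratom (a : ratom S) : bool :=
  (size a.2 == ar a.1) && (a.1 != eqp).

Definition wf_rule (r : rule S) : Prop :=
  match r with
  | Tgd xs ys ws b h =>
      [/\ uniq (xs ++ ys ++ ws),
          [&& xs != [::], b != [::] & h != [::]],
          all wf_ratom b && all wf_ratom h,
          atoms_vars b =i xs ++ ys
        & atoms_vars h =i xs ++ ws]
  | Egd xs b x y =>
      [/\ uniq xs,
          (xs != [::]) && (b != [::]),
          all wf_ratom b,
          atoms_vars b =i xs
        & (x \in xs) && (y \in xs)]
  end.

Definition rule_exvars (r : rule S) : seq (svar S) :=
  if r is Tgd _ _ ws _ _ then ws else [::].

Definition rule_vars (r : rule S) : seq (svar S) :=
  match r with
  | Tgd xs ys ws _ _ => xs ++ ys ++ ws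
  | Egd xs _ _ _ => xs
  end.

(* The equality predicate occurs in every EGD. *)
Definition rule_preds (r : rule S) : seq (spred S) :=
  match r with
  | Tgd _ _ _ b h => atoms_preds b ++ atoms_preds h
  | Egd _ b _ _ => eqp :: atoms_preds b
  end.

Definition is_tgd (r : rule S) : bool := if r is Tgd _ _ _ _ _ then true else false.

Record rule_set := RuleSet {
  rules :> seq (rule S);
  rules_wf : forall r, r \in rules -> wf_rule r;
  rules_exvars : forall r1 r2 w, r1 \in rules -> r2 \in rules ->
    w \in rule_exvars r1 -> w \in rule_vars r2 -> r1 = r2
}.

Record tgd_set := TgdSet {
  tgds :> rule_set;
  tgds_tgd : all is_tgd tgds
}.

Definition occurring_preds (R : seq (rule S)) : seq (spred S) :=
  undup (flatten [seq rule_preds r | r <- R]).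

End Rules.

Arguments Tgd {S}.
Arguments Egd {S}.

(* Terms over the signature enlarged with the special constant [Const None] and
   a fresh Skolem function symbol [inr w] for every variable [w]; the Skolem
   symbols in use are those of the existential variables of the rules. Function
   symbols carry no arity: Skolemisation applies [inr w] only to the universal
   variables shared by body and head of the rule of [w]. *)
Inductive term (S : signature) : Type :=
| Var of svar S
| Const of option (sconst S)
| App of (sfunc S + svar S)%type & seq (term S).

Arguments Var {S}.
Arguments Const {S}.
Arguments App {S}.

Definition star (S : signature) : term S := Const None.
Arguments star {S}.

Section Terms.
Variable S : signature.
Implicit Types (t u : term S) (ts : seq (term S)).

Section TermInd.
Variable P : term S -> Prop.
Hypothesis Pvar : forall v, P (Var v).
Hypothesis Pconst : forall c, P (Const c).
Hypothesis Papp : forall f ts, (forall i, i < size ts -> P (nth star ts i)) ->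
  P (App f ts).

Fixpoint term_nested_ind t : P t :=
  match t with
  | Var v => Pvar v
  | Const c => Pconst c
  | App f ts => Papp f
      ((fix all_ind ts : forall i, i < size ts -> P (nth star ts i) :=
          match ts with
          | [::] => fun i (H : i < 0) => False_ind _ (notF H)
          | u :: us => fun i =>
              match i with
              | 0 => fun _ => term_nested_ind u
              | j.+1 => fun H => all_ind us j H
              end
          end) ts)
  end.
End TermInd.

Let code : eqType :=
  GenTree.tree ((svar S + option (sconst S)) + (sfunc S + svar S))%type.

Fixpoint term_enc t : code :=
  match t with
  | Var v => GenTree.Leaf (inl (inl v))
  | Const c => GenTree.Leaf (inl (inr c))
  | App f ts => GenTree.Node 0 (GenTree.Leaf (inr f) :: map term_enc ts)
  end.

Fixpoint term_dec (c : code) : term S :=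
  match c with
  | GenTree.Leaf (inl (inl v)) => Var v
  | GenTree.Leaf (inl (inr c)) => Const c
  | GenTree.Node _ (GenTree.Leaf (inr f) :: cs) => App f (map term_dec cs)
  | _ => star
  end.

Lemma term_encK : cancel term_enc term_dec.
Proof.
elim/term_nested_ind => //= f ts IH; congr App.
apply: (@eq_from_nth _ star) => [|i]; rewrite !size_map // => lti.
by rewrite -map_comp (nth_map star) //= IH.
Qed.

HB.instance Definition _ := Equality.copy (term S) (can_type term_encK).

Fixpoint dep t : nat :=
  match t with
  | Var _ | Const _ => 1
  | App _ ts => (foldr (fun u m => maxn (dep u) m) 0 ts).+1
  end.

Fixpoint ground t : bool :=
  match t with
  | Var _ => false
  | Const _ => true
  | App _ ts => all ground ts
  end.

Fixpoint fun_occurs (f : (sfunc S + svar S)%type) t : bool :=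
  match t with
  | Var _ | Const _ => false
  | App g ts => (g == f) || has (fun_occurs f) ts
  end.

Definition cyclic t : bool := if t is App f ts then has (fun_occurs f) ts else false.

(* reflexive *)
Fixpoint subterm (s t : term S) : bool :=
  (s == t) || (if t is App _ ts then has (subterm s) ts else false).

Fixpoint subst (sigma : svar S -> term S) t : term S :=
  match t with
  | Var v => sigma v
  | Const c => Const c
  | App f ts => App f (map (subst sigma) ts)
  end.

Definition tatom : Type := (spred S * seq (term S))%type.

Definition inst (sigma : svar S -> term S) (a : ratom S) : tatom :=
  (a.1, map sigma a.2).

Definition sk_var (xs ws : seq (svar S)) (z : svar S) : term S :=
  if z \in ws then App (inr z) (map Var xs) else Var z.

Definition sk_atom (xs ws : seq (svar S)) (a : ratom S) : tatom :=
  (a.1, map (sk_var xs ws) a.2).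

Definition subst_atom (sigma : svar S -> term S) (A : tatom) : tatom :=
  (A.1, map (subst sigma) A.2).

(* [A[t/u]]: only the occurrences of [t] as an argument of the predicate are
   replaced by [u]. *)
Definition repl_atom t u (A : tatom) : tatom :=
  (A.1, [seq (if s == t then u else s) | s <- A.2]).

(* The minimal atom set closed under the conditions listed by the
   constructors. *)
Inductive chase (R : seq (rule S)) : tatom -> Prop :=
| chase_crit P : P \in occurring_preds R -> chase R (P, nseq (ar P) star)
| chase_tgd xs ys ws b h sigma a :
    Tgd xs ys ws b h \in R -> (forall z, ground (sigma z)) ->
    (forall a', a' \in b -> chase R (inst sigma a')) ->
    a \in h -> chase R (subst_atom sigma (sk_atom xs ws a))
| chase_egd_l xs b x y sigma A :
    Egd xs b x y \in R -> (forall z, ground (sigma z)) ->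
    (forall a', a' \in b -> chase R (inst sigma a')) ->
    dep (sigma x) <= dep (sigma y) ->
    chase R A -> chase R (repl_atom (sigma y) (sigma x) A)
| chase_egd_r xs b x y sigma A :
    Egd xs b x y \in R -> (forall z, ground (sigma z)) ->
    (forall a', a' \in b -> chase R (inst sigma a')) ->
    dep (sigma y) <= dep (sigma x) ->
    chase R A -> chase R (repl_atom (sigma x) (sigma y) A).

(* Terms contained in the atom set may be nested inside arguments. *)
Definition EMFA (R : rule_set S) : Prop :=
  forall (A : tatom) (s t : term S),
    chase R A -> s \in A.2 -> subterm t s -> ~~ cyclic t.

Definition MFA (T : tgd_set S) : Prop := EMFA T.

End Terms.

(* The standard axiomatisation lives in an enlarged signature: [None] is the
   fresh binary predicate Eq, [Some P] is the predicate [P] of [S], and the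
   variables [inr _] are those of the added equality axioms. *)
Definition max_ar (S : signature) : nat := \max_(P : spred S) ar P.

Definition st_sig (S : signature) : signature :=
  @Signature (sconst S) (sfunc S) (svar S + 'I_(max_ar S).+3)%type
    (option (spred S)) (fun P => if P is Some P' then ar P' else 2)
    (Some eqp) (ar_eqp S).

Section St.
Variable S : signature.

Definition lift_var (z : svar S) : svar (st_sig S) := inl z.

Definition lift_ratom (a : ratom S) : ratom (st_sig S) :=
  (Some a.1, map lift_var a.2).

Definition ax_var (i : nat) : svar (st_sig S) := inr (inord i).

Definition Eq_atom (x y : svar (st_sig S)) : ratom (st_sig S) := (None, [:: x; y]).

Definition st_rule (r : rule S) : rule (st_sig S) :=
  match r with
  | Tgd xs ys ws b h =>
      Tgd (map lift_var xs) (map lift_var ys) (map lift_var ws)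
        (map lift_ratom b) (map lift_ratom h)
  | Egd xs b x y =>
      let fr := undup [:: x; y] in
      Tgd (map lift_var fr) (map lift_var [seq z <- xs | z \notin fr]) [::]
        (map lift_ratom b) [:: Eq_atom (lift_var x) (lift_var y)]
  end.

Definition st_refl (P : spred S) : rule (st_sig S) :=
  let xs := mkseq ax_var (ar P) in
  Tgd xs [::] [::] [:: (Some P, xs)] [seq Eq_atom x x | x <- xs].

Definition st_sym : rule (st_sig S) :=
  Tgd [:: ax_var 0; ax_var 1] [::] [::]
    [:: Eq_atom (ax_var 0) (ax_var 1)] [:: Eq_atom (ax_var 1) (ax_var 0)].

Definition st_trans : rule (st_sig S) :=
  Tgd [:: ax_var 0; ax_var 2] [:: ax_var 1] [::]
    [:: Eq_atom (ax_var 0) (ax_var 1); Eq_atom (ax_var 1) (ax_var 2)]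
    [:: Eq_atom (ax_var 0) (ax_var 2)].

(* The variable replacing the one at position [i] is [ax_var (ar P)]. *)
Definition st_congr (P : spred S) (i : nat) : rule (st_sig S) :=
  let xs := mkseq ax_var (ar P) in
  let xs' := mkseq (fun j => ax_var (if j == i then ar P else j)) (ar P) in
  Tgd xs' [:: ax_var i] [::]
    [:: (Some P, xs); Eq_atom (ax_var i) (ax_var (ar P))] [:: (Some P, xs')].

(* The reflexivity rule of a nullary predicate would have an empty head and no
   variables, so it is not a rule and is omitted. *)
Definition st_rules (R : seq (rule S)) : seq (rule (st_sig S)) :=
  let Ps := [seq P <- occurring_preds R | P != eqp] in
  map st_rule R
  ++ [seq st_refl P | P <- Ps & 0 < ar P]
  ++ [:: st_sym; st_trans]
  ++ flatten [seq [seq st_congr P i | i <- iota 0 (ar P)] | P <- Ps].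

Lemma lift_var_inj : injective lift_var.
Proof. by move=> x y []. Qed.

Lemma ax_var_inj i j : i < (max_ar S).+3 -> j < (max_ar S).+3 ->
  ax_var i = ax_var j -> i = j.
Proof. by move=> hi hj [] /(congr1 val) /=; rewrite !inordK. Qed.

Lemma ax_var_eq i j : i < (max_ar S).+3 -> j < (max_ar S).+3 ->
  (ax_var i == ax_var j) = (i == j).
Proof. by move=> hi hj; apply/eqP/eqP => [/ax_var_inj ->|->]. Qed.

Lemma leq_max_ar (P : spred S) : ar P <= max_ar S.
Proof. exact: (leq_bigmax P). Qed.

Lemma ax_var_wide (P : spred S) i : i <= ar P -> i < (max_ar S).+3.
Proof. by move=> le; rewrite ltnS (leq_trans le) // (leq_trans (leq_max_ar P)) // ltnW. Qed.

Lemma atoms_vars_lift (b : seq (ratom S)) :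
  atoms_vars (map lift_ratom b) = map lift_var (atoms_vars b).
Proof. by rewrite /atoms_vars map_flatten -!map_comp. Qed.

Lemma wf_lift (b : seq (ratom S)) :
  all (@wf_ratom S) b -> all (@wf_ratom (st_sig S)) (map lift_ratom b).
Proof.
move=> /allP wb; rewrite all_map; apply/allP => a /wb /andP[sa na].
by rewrite /= /wf_ratom /= size_map sa.
Qed.

Lemma map_lift_eqi (s1 s2 : seq (svar S)) :
  s1 =i s2 -> map lift_var s1 =i map lift_var s2.
Proof. by move=> e z; apply/mapP/mapP => -[u]; rewrite ?e -?e => *; exists u; rewrite // ?e // -e. Qed.

Lemma map_nil (T1 T2 : eqType) (f : T1 -> T2) s : (map f s != [::]) = (s != [::]).
Proof. by case: s. Qed.

Lemma st_rule_wf (r : rule S) : wf_rule r -> wf_rule (st_rule r).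
Proof.
case: r => [xs ys ws b h|xs b x y] /=.
  case=> u /and3P[nx nb nh] /andP[wb wh] vb vh; split.
  - by rewrite -!map_cat (map_inj_uniq lift_var_inj).
  - by rewrite !map_nil nx nb nh.
  - by rewrite !wf_lift.
  - by rewrite atoms_vars_lift -map_cat; exact: map_lift_eqi.
  - by rewrite atoms_vars_lift -map_cat; exact: map_lift_eqi.
case=> u /andP[nx nb] wb vb /andP[xx xy].
have -> : (if x \in [:: y] then [:: y] else [:: x; y]) = undup [:: x; y] by [].
set fr := undup _.
have sfr z : z \in fr -> z \in xs.
  by rewrite mem_undup !inE => /orP[]/eqP->.
split.
- rewrite cats0 -map_cat (map_inj_uniq lift_var_inj) cat_uniq undup_uniq /=.
  rewrite filter_uniq // andbT; apply/hasPn => z.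
  by rewrite mem_filter => /andP[].
- rewrite !map_nil nb /= andbT; apply/eqP => e.
  by have := mem_undup [:: x; y] x; rewrite -/fr e !inE eqxx.
- by rewrite wf_lift.
- rewrite atoms_vars_lift -map_cat; apply: map_lift_eqi => z.
  rewrite vb mem_cat mem_filter; case: (boolP (z \in fr)) => [/sfr ->|] //=.
- move=> z; rewrite cats0 /atoms_vars /=.
  have -> : [:: lift_var x; lift_var y] = map lift_var [:: x; y] by [].
  by apply: map_lift_eqi => t; rewrite mem_undup.
Qed.

Lemma st_refl_wf (P : spred S) : 0 < ar P -> P != eqp -> wf_rule (st_refl P).
Proof.
move=> n0 nP; split.
- rewrite /= ?cats0 map_inj_in_uniq ?iota_uniq // => i j.
  rewrite !mem_iota !add0n => /andP[_ hi] /andP[_ hj].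
  by apply: ax_var_inj; apply: (ax_var_wide (P := P)); exact: ltnW.
- by rewrite /= !map_nil; case: (ar P) n0.
- rewrite /= {1}/wf_ratom /= size_mkseq eqxx nP /=.
  by apply/allP => a /mapP[x _ ->].
- by move=> z; rewrite /atoms_vars /= !cats0.
- move=> z; rewrite cats0 /atoms_vars; elim: (mkseq _ _) => //= x s IH.
  by rewrite !in_cons IH orbA orbb.
Qed.

Lemma st_sym_wf : wf_rule st_sym.
Proof.
split=> //=; first by rewrite !inE ax_var_eq.
by move=> z; rewrite !inE orbC.
Qed.

Lemma st_trans_wf : wf_rule st_trans.
Proof.
split=> //=; first by rewrite !inE !ax_var_eq.
by move=> z; rewrite !inE; case: (z == ax_var 0); case: (z == ax_var 1); case: (z == ax_var 2).
Qed.

Lemma st_congr_wf (P : spred S) i : i < ar P -> P != eqp -> wf_rule (st_congr P i).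
Proof.
move=> hi nP.
have wide j : j < ar P -> (if j == i then ar P else j) <= ar P.
  by case: ifP => // _; exact: ltnW.
have inj : {in iota 0 (ar P) &,
    injective (fun j => ax_var (if j == i then ar P else j))}.
  move=> j k; rewrite !mem_iota !add0n /= => hj hk.
  move/(ax_var_inj (ax_var_wide (wide j hj)) (ax_var_wide (wide k hk))).
  case: eqP => [->|_]; case: eqP => [->|_] // e.
    by rewrite -e ltnn in hk.
  by rewrite e ltnn in hj.
split.
- rewrite /= cat_uniq map_inj_in_uniq ?iota_uniq //= orbF andbT.
  apply/mapP => -[j]; rewrite mem_iota add0n => /andP[_ hj].
  move/(ax_var_inj (ax_var_wide (ltnW hi)) (ax_var_wide (wide j hj))).
  case: eqP => [_ e|ne e]; last exact: ne.
  by rewrite -e ltnn in hi.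
- by rewrite map_nil; case: (ar P) hi.
- by rewrite /= /wf_ratom /= !size_mkseq eqxx nP.
- move=> z; rewrite /atoms_vars /= mem_cat [in RHS]mem_cat !inE.
  apply/idP/idP.
    case/orP=> [/mapP[j]|/orP[/eqP->|/eqP->]].
    + rewrite mem_iota add0n => /andP[_ hj] ->.
      have [->|ne] := eqVneq j i; first by rewrite eqxx orbT.
      apply/orP; left; apply/mapP; exists j; last by rewrite (negbTE ne).
      by rewrite mem_iota.
    + by rewrite eqxx orbT.
    + apply/orP; left; apply/mapP; exists i; last by rewrite eqxx.
      by rewrite mem_iota.
  case/orP=> [/mapP[j]|/eqP->]; last by rewrite eqxx /= orbT.
  rewrite mem_iota add0n => /andP[_ hj] ->; case: eqP => _.
    by rewrite eqxx !orbT.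
  by apply/orP; left; apply/mapP; exists j => //; rewrite mem_iota.
- by move=> z; rewrite /atoms_vars /= !cats0.
Qed.

Lemma st_rules_wf (R : rule_set S) r : r \in st_rules R -> wf_rule r.
Proof.
rewrite !mem_cat => /or4P[].
- by case/mapP=> r0 /rules_wf w ->; exact: st_rule_wf.
- case/mapP=> P; rewrite !mem_filter => /and3P[n0 nP _] ->.
  exact: st_refl_wf.
- by rewrite !inE => /orP[]/eqP->; [exact: st_sym_wf|exact: st_trans_wf].
- case/flatten_mapP=> P; rewrite mem_filter => /andP[nP _] /mapP[i].
  by rewrite mem_iota add0n => /andP[_ hi] ->; exact: st_congr_wf.
Qed.

Lemma st_rule_exvars (r : rule S) : rule_exvars (st_rule r) = map lift_var (rule_exvars r).
Proof. by case: r. Qed.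

Lemma st_rules_exvars (R : rule_set S) r1 r2 w :
  r1 \in st_rules R -> r2 \in st_rules R ->
  w \in rule_exvars r1 -> w \in rule_vars r2 -> r1 = r2.
Proof.
rewrite !mem_cat => /or4P[]; last 3 first.
- by case/mapP=> P _ ->.
- by rewrite !inE => /orP[]/eqP->.
- by case/flatten_mapP=> P _ /mapP[i _ ->].
case/mapP=> a aR -> h2; rewrite st_rule_exvars => /mapP[z za ->].
case/or4P: h2.
- case/mapP=> b bR -> zb; congr st_rule.
  apply: (rules_exvars aR bR za); move: zb (rules_wf bR); case: b {bR} => [xs ys ws b h|xs b x y] /=.
    by rewrite -!map_cat mem_map => //; exact: lift_var_inj.
  rewrite cats0 -map_cat mem_map; last exact: lift_var_inj.
  move=> zb [_ _ _ _ /andP[xx xy]].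
  have := mem_cat z (undup [:: x; y]) [seq z <- xs | z \notin undup [:: x; y]].
  rewrite zb mem_undup mem_filter !inE => /esym/orP[/orP[]/eqP->|/andP[]] //.
- by case/mapP=> P _ ->; rewrite /= cats0 => /mapP[].
- by rewrite !inE => /orP[]/eqP->; rewrite /= !inE.
- by case/flatten_mapP=> P _ /mapP[i _ ->]; rewrite /= mem_cat inE orbF => /mapP[].
Qed.

Lemma st_rules_tgd (R : seq (rule S)) : all (@is_tgd _) (st_rules R).
Proof.
rewrite !all_cat /=; apply/and3P; split.
- by apply/allP => r /mapP[r0 _ ->]; case: r0.
- by apply/allP => r /mapP[P _ ->].
- by apply/allP => r /flatten_mapP[P _ /mapP[i _ ->]].
Qed.

Definition St (R : rule_set S) : tgd_set (st_sig S) :=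
  @TgdSet _ (RuleSet (@st_rules_wf R) (@st_rules_exvars R)) (st_rules_tgd R).

End St.

(* Main.v *)
Require Import Defs.
From mathcomp Require Import all_boot.

(** Every atom of M(R) over a predicate other than equality also belongs to
    M(St(R)), since replacing a term by an equal one is a sequence of
    applications of the congruence rules of St(R), one per argument position.
    Equality itself never occurs in a body or in a head, so its atoms descend
    from the critical instance by replacements only; these never increase the
    depth, which therefore stays 1. *)

Set Implicit Arguments.
Unset Strict Implicit.
Unset Printing Implicit Defensive.

(** * Terms and invariants of the chase *)

Section Terms.
Variable S : signature.
Implicit Types (t u : term S) (R : seq (rule S)).

Lemma term_mem_ind (P : term S -> Prop) :
  (forall v, P (Var v)) -> (forall c, P (Const c)) ->
  (forall f ts, {in ts, forall t, P t} -> P (App f ts)) -> forall t, P t.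
Proof.
move=> Pv Pc Pa; elim/term_nested_ind => // f ts IH; apply: Pa => t tts.
by rewrite -(nth_index star tts); apply: IH; rewrite index_mem.
Qed.

Lemma dep_gt0 t : 0 < dep t.
Proof. by case: t. Qed.

(** Function symbols carry no arity, so besides variables and constants depth 1 admits [App f [::]];
    each of these has itself as sole subterm. *)
Lemma dep1_acyclic t u : dep u <= 1 -> subterm t u -> ~~ cyclic t.
Proof.
case: u => [v|c|f [|s ss]] /=; rewrite ?orbF; try by move=> _ /eqP->.
by rewrite ltnS geq_max leqNgt dep_gt0.
Qed.

Lemma ground_subst (sigma : svar S -> term S) t :
  (forall z, ground (sigma z)) -> ground (subst sigma t).
Proof.
move=> gs; elim/term_mem_ind: t => //= f ts IH.
by rewrite all_map; apply/allP.
Qed.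

(** Since [chase_tgd] demands ground substitutions, those built from arguments of derived atoms to
    match the axioms of St(R) need this invariant. *)
Lemma chase_ground R A : chase R A -> all (@ground S) A.2.
Proof.
have repl t u (s : seq (term S)) : ground u -> all (@ground S) s ->
    all (@ground S) [seq (if x == t then u else x) | x <- s].
  move=> gu /allP gs; rewrite all_map; apply/allP => x /gs gx /=.
  by case: ifP.
elim=> [P _|xs ys ws b h sigma a _ gs _ _ _|xs b x y sigma {}A _ gs _ _ _ _ IH
  |xs b x y sigma {}A _ gs _ _ _ _ IH] /=.
- by rewrite all_nseq orbT.
- by rewrite all_map; apply/allP => t _; exact: ground_subst.
- exact: repl.
- exact: repl.
Qed.

Lemma rule_preds_occurring R r P :
  r \in R -> P \in rule_preds r -> P \in occurring_preds R.
Proof.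
by move=> rR Pr; rewrite mem_undup; apply/flatten_mapP; exists r.
Qed.

Lemma chase_pred R A : chase R A -> A.1 \in occurring_preds R.
Proof.
elim=> //= xs ys ws b h sigma a rR _ _ _ ah.
by apply: (rule_preds_occurring rR); rewrite mem_cat [_ \in atoms_preds h]map_f ?orbT.
Qed.

Lemma chase_size (R : rule_set S) A : chase R A -> size A.2 = ar A.1.
Proof.
elim=> [P _|xs ys ws b h sigma a /rules_wf [_ _ /andP[_ /allP wh] _ _] _ _ _ ah
  |xs b x y sigma {}A _ _ _ _ _ _ IH|xs b x y sigma {}A _ _ _ _ _ _ IH] /=.
- by rewrite size_nseq.
- by rewrite !size_map; case/andP: (wh _ ah) => /eqP.
- by rewrite size_map.
- by rewrite size_map.
Qed.

End Terms.

(** * Embedding terms and atoms into the signature of St(R) *)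

Section Lift.
Variable S : signature.
Implicit Types (t u : term S).

(** St renames existential variables by [lift_var], and the Skolem symbols named after them must
    follow. *)
Definition lift_fun (f : sfunc S + svar S) :
    sfunc (st_sig S) + svar (st_sig S) :=
  match f with inl g => inl g | inr w => inr (lift_var w) end.

Fixpoint lift_term t : term (st_sig S) :=
  match t with
  | Var v => Var (lift_var v)
  | Const c => @Const (st_sig S) c
  | App f ts => App (lift_fun f) (map lift_term ts)
  end.

Definition lift_tatom (A : tatom S) : tatom (st_sig S) :=
  (Some A.1, map lift_term A.2).

(** Axiom variables do not occur in lifted rules; they are sent to [star] because a substitution
    must be ground everywhere. *)
Definition lift_subst (sigma : svar S -> term S) (z : svar (st_sig S)) :
    term (st_sig S) :=
  match z with inl v => lift_term (sigma v) | inr _ => star end.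

Lemma lift_fun_inj : injective lift_fun.
Proof. by case=> [f|f] [g|g] //= [->]. Qed.

Lemma ground_lift t : ground (lift_term t) = ground t.
Proof.
elim/term_mem_ind: t => //= f ts IH.
by rewrite all_map; apply: eq_in_all.
Qed.

Lemma ground_lift_subst (sigma : svar S -> term S) :
  (forall z, ground (sigma z)) -> forall z, ground (lift_subst sigma z).
Proof. by move=> gs [z|z] //=; rewrite ground_lift. Qed.

Lemma fun_occurs_lift f t : fun_occurs (lift_fun f) (lift_term t) = fun_occurs f t.
Proof.
elim/term_mem_ind: t => //= g ts IH.
by rewrite (inj_eq lift_fun_inj) has_map; congr orb; apply: eq_in_has.
Qed.

Lemma cyclic_lift t : cyclic (lift_term t) = cyclic t.
Proof.
case: t => //= f ts; rewrite has_map; apply: eq_has => t /=.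
exact: fun_occurs_lift.
Qed.

Lemma subterm_lift t u : subterm t u -> subterm (lift_term t) (lift_term u).
Proof.
elim/term_mem_ind: u => [v|c|f ts IH] /=; rewrite ?orbF;
  try by move/eqP=> ->; rewrite /= eqxx.
case/orP=> [/eqP->|/hasP[s sts ts_s]]; first by rewrite /= eqxx.
apply/orP; right; rewrite has_map; apply/hasP; exists s => //=.
exact: IH.
Qed.

Lemma inst_lift (sigma : svar S -> term S) a :
  inst (lift_subst sigma) (lift_ratom a) = lift_tatom (inst sigma a).
Proof. by rewrite /inst /lift_tatom /= -!map_comp. Qed.

Lemma subst_sk_lift (sigma : svar S -> term S) xs ws a :
  subst_atom (lift_subst sigma)
    (sk_atom (map (@lift_var S) xs) (map (@lift_var S) ws) (lift_ratom a)) =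
  lift_tatom (subst_atom sigma (sk_atom xs ws a)).
Proof.
rewrite /subst_atom /sk_atom /lift_tatom /= -!map_comp; congr pair.
apply: eq_map => z /=; rewrite /sk_var (mem_map (@lift_var_inj S)).
by case: ifP => //= _; rewrite -!map_comp.
Qed.

(** Equality is excluded because an EGD mentions it, while the TGD that replaces the EGD has the
    fresh Eq in its head. *)
Lemma Some_occurring (R : seq (rule S)) P :
  P != eqp -> P \in occurring_preds R ->
  (Some P : spred (st_sig S)) \in occurring_preds (st_rules R).
Proof.
move=> nP; rewrite mem_undup => /flatten_mapP[r rR Pr].
apply: (@rule_preds_occurring _ _ (st_rule r)).
  by rewrite mem_cat map_f.
have lift_preds b : P \in atoms_preds b ->
    (Some P : spred (st_sig S)) \in atoms_preds (map (@lift_ratom S) b).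
  case/mapP=> a ab ->; apply/mapP.
  by exists (lift_ratom a) => //; exact: map_f.
case: r {rR} Pr => [xs ys ws b h|xs b x y] /=.
  by rewrite !mem_cat => /orP[/lift_preds->//|/lift_preds->]; rewrite orbT.
rewrite in_cons (negbTE nP) /= mem_cat.
by move/lift_preds->.
Qed.

End Lift.

(** * Simulating M(R) inside M(St(R)) *)

Section StChase.
Variables (S : signature) (R : rule_set S).

Lemma chase_sym (t u : term (st_sig S)) :
  chase (St R) (None, [:: t; u]) -> chase (St R) (None, [:: u; t]).
Proof.
move=> tu; have := chase_ground tu; rewrite /= andbT => /andP[gt gu].
pose sigma (z : svar (st_sig S)) := if z == ax_var S 0 then t else u.
have s0 : sigma (ax_var S 0) = t by rewrite /sigma eqxx.
have s1 : sigma (ax_var S 1) = u by rewrite /sigma ax_var_eq.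
have := @chase_tgd _ (St R) _ _ _ _ _ sigma (Eq_atom (ax_var S 1) (ax_var S 0))
  (_ : st_sym S \in _).
rewrite /subst_atom /= s0 s1; apply.
- by rewrite !mem_cat mem_head !orbT.
- by move=> z; rewrite /sigma; case: ifP.
- by move=> a; rewrite inE => /eqP->; rewrite /inst /= s0 s1.
- exact: mem_head.
Qed.

(** A single congruence step at position [size p]. *)
Lemma chase_congr P p q (t u : term (st_sig S)) :
  P != eqp -> P \in occurring_preds R ->
  chase (St R) (None, [:: t; u]) -> chase (St R) (Some P, p ++ t :: q) ->
  chase (St R) (Some P, p ++ u :: q).
Proof.
move=> nP oP tu cP; have := chase_ground tu; rewrite /= andbT => /andP[_ gu].
have gP := chase_ground cP; have sP := chase_size cP; rewrite /= in gP sP.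
set i := size p; have lti : i < ar P by rewrite -sP size_cat /= addnS ltnS leq_addr.
(* [ax_var j] is mapped to entry [j]. The variable replacing the one at position [i] has index
   [ar P], hence [u] is appended at the end. *)
pose args := rcons (p ++ t :: q) u.
pose sigma (z : svar (st_sig S)) : term (st_sig S) :=
  if z is inr j then nth star args j else star.
have sE j : j <= ar P -> sigma (ax_var S j) = nth star args j.
  by move=> lej; rewrite /sigma /ax_var /= inordK // (ax_var_wide lej).
have argsE j : j < ar P -> nth star args j = nth star (p ++ t :: q) j.
  by move=> ltj; rewrite nth_rcons sP ltj.
have args_last : nth star args (ar P) = u by rewrite nth_rcons sP ltnn eqxx.
have argsi : nth star args i = t by rewrite argsE // nth_cat ltnn subnn.
have head_eq : subst_atom sigma (sk_atom
    (mkseq (fun j => ax_var S (if j == i then ar P else j)) (ar P)) [::]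
    (Some P, mkseq (fun j => ax_var S (if j == i then ar P else j)) (ar P))) =
    (Some P, p ++ u :: q).
  rewrite /subst_atom /sk_atom /= -!map_comp; congr pair.
  apply: (@eq_from_nth _ star) => [|j].
    by rewrite size_map size_iota -sP !size_cat.
  rewrite size_map size_iota => ltj.
  rewrite (nth_map 0) ?size_iota // nth_iota // add0n.
  rewrite /comp /sk_var /=; case: eqP => [->|/eqP ne].
    by rewrite [LHS]sE // args_last nth_cat ltnn subnn.
  rewrite [LHS]sE ?argsE //; last exact: ltnW.
  rewrite !nth_cat; case: ltnP => // lej.
  (* Past position [i] both lists continue with [q]. *)
  have : i < j by rewrite ltn_neqAle eq_sym ne.
  by rewrite -subn_gt0; case: (j - size p).
rewrite -head_eq; apply: (@chase_tgd _ (St R) _ _ _ _ _ sigma _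
  (_ : st_congr P i \in _)).
- rewrite !mem_cat; apply/or4P/Or44/flatten_mapP; exists P.
    by rewrite mem_filter nP.
  by apply: map_f; rewrite mem_iota.
(* Variables indexed beyond [args] receive the default [star], which is ground. *)
- case=> // j /=; have [ltj|lej] := ltnP j (size args).
    by apply: (allP (_ : all _ args)); rewrite ?all_rcons ?gu ?mem_nth.
  by rewrite nth_default.
- move=> a; rewrite !inE => /orP[]/eqP->; rewrite /inst /=.
    suff -> : [seq sigma z | z <- mkseq (ax_var S) (ar P)] = p ++ t :: q by [].
    apply: (@eq_from_nth _ star) => [|j].
      by rewrite size_map size_mkseq sP.
    rewrite size_map size_mkseq => ltj.
    by rewrite (nth_map (ax_var S 0)) ?size_mkseq // nth_mkseq // sE ?argsE // ltnW.
  change (chase (St R) (None, [:: sigma (ax_var S i); sigma (ax_var S (ar P))])).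
  by rewrite !sE ?argsi ?args_last // ltnW.
- exact: mem_head.
Qed.

Lemma chase_repl (A : tatom S) (t u : term S) :
  A.1 != eqp -> A.1 \in occurring_preds R ->
  chase (St R) (None, [:: lift_term t; lift_term u]) ->
  chase (St R) (lift_tatom A) -> chase (St R) (lift_tatom (repl_atom t u A)).
Proof.
case: A => P s /= nP oP tu; rewrite /lift_tatom /=.
(* The arguments are treated from left to right; [p] collects those already processed. *)
suff H p : chase (St R) (Some P, p ++ map (@lift_term S) s) ->
    chase (St R) (Some P, p ++ map (@lift_term S)
      [seq (if x == t then u else x) | x <- s]) by exact: (H [::]).
elim: s p => //= x s IH p; rewrite -!cat_rcons => cx; apply: IH.
rewrite cat_rcons; case: eqP => [xt|_]; last by rewrite -cat_rcons.
by apply: (chase_congr nP oP tu); rewrite -xt -cat_rcons.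
Qed.

Lemma chase_egd_Eq xs b x y (sigma : svar S -> term S) :
  Egd xs b x y \in rules R -> (forall z, ground (sigma z)) ->
  (forall a, a \in b -> chase (St R) (lift_tatom (inst sigma a))) ->
  chase (St R) (None, [:: lift_term (sigma x); lift_term (sigma y)]).
Proof.
move=> rR gs cb.
apply: (@chase_tgd _ (St R) _ _ _ _ _ (lift_subst sigma)
  (Eq_atom (lift_var x) (lift_var y)) (_ : st_rule (Egd xs b x y) \in _)).
- by rewrite mem_cat map_f.
- exact: ground_lift_subst.
- by move=> _ /mapP[a ab ->]; rewrite inst_lift; exact: cb.
- exact: mem_head.
Qed.

(** The invariant of the simulation. St(R) has no congruence rules for [eqp], so its atoms are
    tracked by depth instead of by membership in M(St(R)). *)
Definition lifted (A : tatom S) : Prop :=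
  if A.1 == eqp then is_true (all (fun t => dep t <= 1) A.2)
  else chase (St R) (lift_tatom A).

Lemma chase_lift (A : tatom S) : chase R A -> lifted A.
Proof.
have neq_eqp b a : all (@wf_ratom S) b -> a \in b -> (a.1 == eqp) = false.
  by move=> /allP wb /wb /andP[_ /negbTE].
have body (sigma : svar S -> term S) b : all (@wf_ratom S) b ->
    (forall a, a \in b -> lifted (inst sigma a)) ->
    forall a, a \in b -> chase (St R) (lift_tatom (inst sigma a)).
  by move=> wb IH a ab; have := IH a ab; rewrite /lifted (neq_eqp b).
have repl (B : tatom S) t u : chase R B -> dep u <= dep t ->
    chase (St R) (None, [:: lift_term t; lift_term u]) ->
    lifted B -> lifted (repl_atom t u B).
  (* On equality atoms the bound survives because [u] is no deeper than the [t] it replaces; on the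
     others congruence applies. *)
  rewrite /lifted => cB le_ut eq_tu /=; case: ifPn => [_ /allP dB|nB].
    rewrite all_map; apply/allP => s /dB /= ds.
    by case: eqP => // st; rewrite st in ds; exact: leq_trans ds.
  by apply: chase_repl => //; exact: chase_pred.
elim=> [P oP|xs ys ws b h sigma a rR gs _ IH ah
  |xs b x y sigma {}A rR gs _ IH le_xy cA IHA
  |xs b x y sigma {}A rR gs _ IH le_yx cA IHA].
- rewrite /lifted /=; case: ifPn => nP; first by rewrite all_nseq orbT.
  rewrite /lift_tatom /= map_nseq.
  exact: (@chase_crit _ (St R) (Some P) (Some_occurring nP oP)).
- have [_ _ /andP[wb wh] _ _] := rules_wf rR.
  rewrite /lifted (neq_eqp h) // -subst_sk_lift.
  apply: (@chase_tgd _ (St R) _ _ _ _ _ (lift_subst sigma)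
    (lift_ratom a) (_ : st_rule (Tgd xs ys ws b h) \in _)).
  + by rewrite mem_cat map_f.
  + exact: ground_lift_subst.
  + by move=> _ /mapP[a' ab ->]; rewrite inst_lift; apply: (body _ b).
  + exact: map_f.
- have [_ _ wb _ _] := rules_wf rR.
  (* Here [sigma y] is replaced by [sigma x], against the orientation of the derived Eq atom, whence
     the symmetry axiom. *)
  apply: repl => //; apply: chase_sym.
  exact: (chase_egd_Eq rR gs (body _ _ wb IH)).
- have [_ _ wb _ _] := rules_wf rR.
  apply: repl => //.
  exact: (chase_egd_Eq rR gs (body _ _ wb IH)).
Qed.

End StChase.

Theorem theorem8 : forall (S : signature) (R : rule_set S), MFA (St R) -> EMFA R.
Proof.
move=> S R mfa A s t /chase_lift; rewrite /lifted; case: ifP => _ cA sA ts.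
  by apply: dep1_acyclic ts; exact: (allP cA).
(* Lifting preserves subterms and cyclicity, so a cyclic term in a non-equality atom would give one
   in M(St(R)). *)
rewrite -cyclic_lift; apply: (mfa _ (lift_term s)) (subterm_lift ts) => //.
  exact: cA.
exact: map_f.
Qed.
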